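(* Let $\Omega\subset\mathbb{R}^2$ be open and let $u:\Omega\to\mathbb{S}^1$ be smooth and satisfy $u^\perp\cdot\nabla(\mathrm{div}\,u)=0$ in $\Omega$, where $u^\perp=(-u_2,u_1)$. Write $u$ locally in terms of a lifting, $u(x,y)=e^{i\theta(x,y)}=(\cos\theta,\sin\theta)$, and define the scalar $v:=\mathrm{div}\,u$. Then the equation $u^\perp\cdot\nabla(\mathrm{div}\,u)=0$ is equivalent to the following system for the two scalars $\theta$ and $v$: $$-\sin\theta\,\theta_x+\cos\theta\,\theta_y=v,\qquad -\sin\theta\,v_x+\cos\theta\,v_y=0.$$ Consequently, starting from any initial curve in $\Omega$ parametrized via $s\mapsto(x_0(s),y_0(s))$ along which $\theta$ and $v$ take values $\theta_0(s)$ and $v_0(s)$ respectively, the characteristic curves $t\mapsto(x(s,t),y(s,t))$ of this system are given by $$x(s,t)=\frac1{v_0(s)}\big[\cos(v_0(s)t+\theta_0(s))-\cos\theta_0(s)\big]+x_0(s),$$ $$y(s,t)=\frac1{v_0(s)}\big[\sin(v_0(s)t+\theta_0(s))-\sin\theta_0(s)\big]+y_0(s),$$ whenever $v_0(s)\neq0$. The corresponding solutions $\theta(s,t)$ and $v(s,t)$ (the values of $\theta$ and $v$ at $(x(s,t),y(s,t))$) are given by $$\theta(s,t)=v_0(s)t+\theta_0(s),\qquad v(s,t)=v_0(s),$$ so that the characteristics are circular arcs of curvature $v_0(s)$ and carry constant values of the divergence. In case the divergence vanishes somewhere along the initial curve, i.e. $v_0(s)=0$, the characteristic is a straight line.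
   Context: The characteristic curves of the system are the curves $t\mapsto(x(s,t),y(s,t))$ in $\Omega$ with $\partial_tx=-\sin\theta$, $\partial_ty=\cos\theta$ and $(x(s,0),y(s,0))=(x_0(s),y_0(s))$; the formulas are understood for those $t$ for which the characteristic remains in the region where the lifting $\theta$ is defined. *)

(* Defs.v *)
From Stdlib Require Export Reals.
From Coquelicot Require Export Coquelicot.

Open Scope R_scope.

(* Regions of the plane are predicates on R * R; fields on them are total
   curried functions whose values off the region play no role: the regions
   considered are open, so partial derivatives there are local. *)

Definition smooth_on (U : R * R -> Prop) (f : R -> R -> R) : Prop :=
  forall (n : nat) (x y : R), U (x, y) -> ex_diff_n f n x y.

Definition Dx (f : R -> R -> R) (x y : R) : R := Derive (fun z => f z y) x.
Definition Dy (f : R -> R -> R) (x y : R) : R := Derive (fun z => f x z) y.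

Definition comp1 (u : R -> R -> R * R) (x y : R) : R := fst (u x y).
Definition comp2 (u : R -> R -> R * R) (x y : R) : R := snd (u x y).

Definition grad (f : R -> R -> R) (x y : R) : R * R := (Dx f x y, Dy f x y).

Definition div (u : R -> R -> R * R) (x y : R) : R :=
  Dx (comp1 u) x y + Dy (comp2 u) x y.

Definition perp (w : R * R) : R * R := (- snd w, fst w).

Definition dot (a b : R * R) : R := fst a * fst b + snd a * snd b.

Definition smooth_circle_valued (Omega : R * R -> Prop) (u : R -> R -> R * R)
  : Prop :=
  smooth_on Omega (comp1 u) /\ smooth_on Omega (comp2 u) /\
  forall x y, Omega (x, y) -> comp1 u x y ^ 2 + comp2 u x y ^ 2 = 1.

Definition div_transport (U : R * R -> Prop) (u : R -> R -> R * R) : Prop :=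
  forall x y, U (x, y) -> dot (perp (u x y)) (grad (div u) x y) = 0.

Definition lifting (Omega : R * R -> Prop) (u : R -> R -> R * R)
    (U : R * R -> Prop) (theta : R -> R -> R) : Prop :=
  open U /\ (forall p, U p -> Omega p) /\ smooth_on U theta /\
  forall x y, U (x, y) -> u x y = (cos (theta x y), sin (theta x y)).

Definition scalar_system (U : R * R -> Prop) (theta v : R -> R -> R) : Prop :=
  forall x y, U (x, y) ->
    - sin (theta x y) * Dx theta x y + cos (theta x y) * Dy theta x y = v x y /\
    - sin (theta x y) * Dx v x y + cos (theta x y) * Dy v x y = 0.

Definition initial_curve (Omega : R * R -> Prop) (I : R -> Prop)
    (x0 y0 : R -> R) : Prop :=
  is_connected I /\ continuous_on I x0 /\ continuous_on I y0 /\
  forall s, I s -> Omega (x0 s, y0 s).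

(* Time domains of characteristics: open intervals, possibly unbounded,
   around the initial time 0. *)
Definition time_interval (J : R -> Prop) : Prop :=
  open J /\ is_connected J /\ J 0.

Definition characteristic (U : R * R -> Prop) (theta : R -> R -> R)
    (a b : R) (J : R -> Prop) (x y : R -> R) : Prop :=
  x 0 = a /\ y 0 = b /\
  forall t, J t ->
    U (x t, y t) /\
    is_derive x t (- sin (theta (x t) (y t))) /\
    is_derive y t (cos (theta (x t) (y t))).

(* Signed curvature at t of a regular, twice differentiable plane curve;
   x1 and y1 are the first derivatives of x and y near t. *)
Definition has_curvature (x y : R -> R) (t k : R) : Prop :=
  exists (x1 y1 : R -> R) (x2 y2 : R),
    locally t (fun r => is_derive x r (x1 r)) /\
    locally t (fun r => is_derive y r (y1 r)) /\
    is_derive x1 t x2 /\ is_derive y1 t y2 /\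
    0 < x1 t ^ 2 + y1 t ^ 2 /\
    k = (x1 t * y2 - y1 t * x2) / sqrt (x1 t ^ 2 + y1 t ^ 2) ^ 3.

(* A regular curve on an interval whose trace lies on a circle traverses an
   arc of that circle; the sign of k records the orientation. *)
Definition circular_arc (J : R -> Prop) (x y : R -> R) (k : R) : Prop :=
  (exists a b, forall t, J t -> (x t - a) ^ 2 + (y t - b) ^ 2 = (/ Rabs k) ^ 2) /\
  forall t, J t -> has_curvature x y t k.

(* Main.v *)
(* Locally u is a fixed unit vector rotated by atan (w2 / w1), which gives the
   lifting. Along a characteristic the system reads d(theta)/dt = v, dv/dt = 0,
   so theta is affine in t and the curve is obtained by integrating
   (-sin theta, cos theta). Conversely, along a curve with the explicit formulas
   that stays in U, (theta, v) and (v0 t + theta0, v0) agree by a Gronwall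
   estimate that uses the system at the points of the curve only, so no existence
   theorem for characteristics is needed. *)

Require Import Defs.
From Stdlib Require Import Reals Lra Lia.
From Coquelicot Require Import Coquelicot.
(* [Reals] shadows [Dx] by [Rderiv.Dx]. *)
Import Defs.
Open Scope R_scope.

(** * Calculus of functions with n derivatives on an open set *)

Lemma open_locally_2d (U : R * R -> Prop) (x y : R) :
  open U -> U (x, y) -> locally_2d (fun a b => U (a, b)) x y.
Proof.
  intros HU Hp; apply locally_2d_locally.
  generalize (HU _ Hp); apply filter_imp; intros [a b] H; exact H.
Qed.

(** Fixing the order n makes induction possible: each partial derivative lowers the order by one,
    and smoothness is the statement for all n. *)
Definition diff_n_on (U : R * R -> Prop) (n : nat) (f : R -> R -> R) : Prop :=
  forall x y, U (x, y) -> ex_diff_n f n x y.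

Lemma smooth_on_diff_n_on U f n : smooth_on U f -> diff_n_on U n f.
Proof. intros H x y Hp; exact (H n x y Hp). Qed.

Lemma diff_n_on_continuous U n f x y :
  diff_n_on U n f -> U (x, y) -> continuity_2d_pt f x y.
Proof. intros H Hp; specialize (H x y Hp); destruct n; apply H. Qed.

Lemma diff_n_on_pred U n f : diff_n_on U (S n) f -> diff_n_on U n f.
Proof. intros H x y Hp; apply (ex_diff_n_m (S n) n); [lia | exact (H x y Hp)]. Qed.

Lemma diff_n_on_Dx U n f : diff_n_on U (S n) f -> diff_n_on U n (Dx f).
Proof. intros H x y Hp; apply ex_diff_n_deriv_aux1, H, Hp. Qed.

Lemma diff_n_on_Dy U n f : diff_n_on U (S n) f -> diff_n_on U n (Dy f).
Proof. intros H x y Hp; apply ex_diff_n_deriv_aux2, H, Hp. Qed.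

Lemma diff_n_on_is_Dx U n f x y : diff_n_on U (S n) f -> U (x, y) ->
  is_derive (fun z => f z y) x (Dx f x y).
Proof. intros H Hp; apply Derive_correct, (H x y Hp). Qed.

Lemma diff_n_on_is_Dy U n f x y : diff_n_on U (S n) f -> U (x, y) ->
  is_derive (fun z => f x z) y (Dy f x y).
Proof. intros H Hp; apply Derive_correct, (H x y Hp). Qed.

(** The increment splits into a horizontal step, controlled by the continuity of [fx] at the point,
    and a vertical step through the point, controlled by the derivative in y. *)
Lemma differentiable_of_partials (U : R * R -> Prop) (f fx fy : R -> R -> R) x y :
  open U ->
  (forall a b, U (a, b) -> is_derive (fun z => f z b) a (fx a b)) ->
  (forall a b, U (a, b) -> is_derive (fun z => f a z) b (fy a b)) ->
  U (x, y) -> continuity_2d_pt fx x y ->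
  differentiable_pt_lim f x y (fx x y) (fy x y).
Proof.
  intros HU Hx Hy Hp Cx.
  apply filterdiff_differentiable_pt_lim.
  apply (is_derive_filterdiff f x y fx (fy x y)).
  - generalize (HU _ Hp); apply filter_imp; intros [a b] H; exact (Hx a b H).
  - exact (Hy x y Hp).
  - apply continuity_2d_pt_filterlim in Cx; exact Cx.
Qed.

Lemma smooth_on_differentiable U f x y : open U -> smooth_on U f -> U (x, y) ->
  differentiable_pt_lim f x y (Dx f x y) (Dy f x y).
Proof.
  intros HU Hf Hp.
  pose proof (smooth_on_diff_n_on U f 1 Hf) as H1.
  apply (differentiable_of_partials U); try assumption.
  - intros a b Hab; exact (diff_n_on_is_Dx U 0 f a b H1 Hab).
  - intros a b Hab; exact (diff_n_on_is_Dy U 0 f a b H1 Hab).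
  - exact (diff_n_on_continuous U 0 _ x y (diff_n_on_Dx U 0 f H1) Hp).
Qed.

(** The inductive step for all closure properties below. [fx] and [fy] agree with the partial
    derivatives only on [U]; openness makes this agreement local, which is enough to transfer
    differentiability. *)
Lemma diff_n_on_of_partials U n f fx fy : open U ->
  (forall a b, U (a, b) -> is_derive (fun z => f z b) a (fx a b)) ->
  (forall a b, U (a, b) -> is_derive (fun z => f a z) b (fy a b)) ->
  diff_n_on U n fx -> diff_n_on U n fy -> diff_n_on U (S n) f.
Proof.
  intros HU Hx Hy Cx Cy x y Hp; simpl; repeat split.
  - apply differentiable_continuity_pt; exists (fx x y), (fy x y).
    apply (differentiable_of_partials U); try assumption.
    exact (diff_n_on_continuous U n fx x y Cx Hp).
  - exists (fx x y); exact (Hx x y Hp).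
  - exists (fy x y); exact (Hy x y Hp).
  - apply ex_diff_n_ext_loc with (f := fx); [|exact (Cx x y Hp)].
    generalize (open_locally_2d U x y HU Hp); apply locally_2d_impl.
    apply locally_2d_forall; intros a b Hab; symmetry.
    apply is_derive_unique, (Hx a b Hab).
  - apply ex_diff_n_ext_loc with (f := fy); [|exact (Cy x y Hp)].
    generalize (open_locally_2d U x y HU Hp); apply locally_2d_impl.
    apply locally_2d_forall; intros a b Hab; symmetry.
    apply is_derive_unique, (Hy a b Hab).
Qed.

Lemma diff_n_on_plus U n f g : open U ->
  diff_n_on U n f -> diff_n_on U n g -> diff_n_on U n (fun x y => f x y + g x y).
Proof.
  intros HU; revert f g; induction n as [|n IH]; intros f g Hf Hg.
  - intros x y Hp; split; [|trivial].
    apply continuity_2d_pt_plus; [apply (Hf x y Hp) | apply (Hg x y Hp)].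
  - apply diff_n_on_of_partials with
      (fx := fun x y => Dx f x y + Dx g x y) (fy := fun x y => Dy f x y + Dy g x y).
    + exact HU.
    + intros a b Hp; apply (is_derive_plus (fun z => f z b) (fun z => g z b));
        eapply diff_n_on_is_Dx; eassumption.
    + intros a b Hp; apply (is_derive_plus (fun z => f a z) (fun z => g a z));
        eapply diff_n_on_is_Dy; eassumption.
    + apply IH; apply diff_n_on_Dx; assumption.
    + apply IH; apply diff_n_on_Dy; assumption.
Qed.

Lemma diff_n_on_mult U n f g : open U ->
  diff_n_on U n f -> diff_n_on U n g -> diff_n_on U n (fun x y => f x y * g x y).
Proof.
  intros HU; revert f g; induction n as [|n IH]; intros f g Hf Hg.
  - intros x y Hp; split; [|trivial].
    apply continuity_2d_pt_mult; [apply (Hf x y Hp) | apply (Hg x y Hp)].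
  (* The Leibniz rule keeps undifferentiated factors, so the induction hypothesis also needs [f] and
     [g] at order n. *)
  - pose proof (diff_n_on_pred U n f Hf) as Hf'.
    pose proof (diff_n_on_pred U n g Hg) as Hg'.
    apply diff_n_on_of_partials with
      (fx := fun x y => Dx f x y * g x y + f x y * Dx g x y)
      (fy := fun x y => Dy f x y * g x y + f x y * Dy g x y).
    + exact HU.
    + intros a b Hp; apply (is_derive_mult (fun z => f z b) (fun z => g z b));
        [eapply diff_n_on_is_Dx; eassumption .. | exact Rmult_comm].
    + intros a b Hp; apply (is_derive_mult (fun z => f a z) (fun z => g a z));
        [eapply diff_n_on_is_Dy; eassumption .. | exact Rmult_comm].
    + apply diff_n_on_plus; try assumption; apply IH; try assumption;
        apply diff_n_on_Dx; assumption.
    + apply diff_n_on_plus; try assumption; apply IH; try assumption;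
        apply diff_n_on_Dy; assumption.
Qed.

Lemma diff_n_on_const U n c : diff_n_on U n (fun _ _ => c).
Proof.
  revert c; induction n as [|n IH]; intros c x y Hp; simpl.
  - split; [apply continuity_2d_pt_const | trivial].
  - repeat split; [apply continuity_2d_pt_const | apply ex_derive_const ..| |].
    + apply ex_diff_n_ext_loc with (f := fun _ _ => 0); [|exact (IH 0 x y Hp)].
      apply locally_2d_forall; intros a b; symmetry; apply Derive_const.
    + apply ex_diff_n_ext_loc with (f := fun _ _ => 0); [|exact (IH 0 x y Hp)].
      apply locally_2d_forall; intros a b; symmetry; apply Derive_const.
Qed.

Lemma smooth_on_div Omega u : open Omega ->
  smooth_on Omega (comp1 u) -> smooth_on Omega (comp2 u) ->
  smooth_on Omega (div u).
Proof.
  intros HO H1 H2 n.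
  apply (diff_n_on_plus Omega n (Dx (comp1 u)) (Dy (comp2 u)) HO).
  - apply diff_n_on_Dx, smooth_on_diff_n_on, H1.
  - apply diff_n_on_Dy, smooth_on_diff_n_on, H2.
Qed.

(** * Existence of local liftings *)

Lemma circle_angle a b : a ^ 2 + b ^ 2 = 1 -> exists t, a = cos t /\ b = sin t.
Proof.
  intros H.
  assert (Ha : -1 <= a <= 1) by nra.
  assert (Hs : sqrt (1 - a²) = Rabs b).
  { replace (1 - a²) with (b²) by (unfold Rsqr; lra); apply sqrt_Rsqr_abs. }
  (* The angle [acos a] has sine [Rabs b]; the sign of b decides between it and its opposite. *)
  destruct (Rle_dec 0 b) as [Hb | Hb].
  - exists (acos a); rewrite cos_acos, sin_acos, Hs, Rabs_pos_eq by lra; auto.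
  - exists (- acos a).
    rewrite cos_neg, sin_neg, cos_acos, sin_acos, Hs, Rabs_left by lra; split; lra.
Qed.

(** Positivity of a places the point in the right half circle, the range of angles covered by
    [atan]. *)
Lemma cos_sin_atan_ratio a b : 0 < a -> a ^ 2 + b ^ 2 = 1 ->
  cos (atan (b / a)) = a /\ sin (atan (b / a)) = b.
Proof.
  intros Ha H; rewrite cos_atan, sin_atan.
  assert (E : sqrt (1 + (b / a)²) = / a).
  { replace (1 + (b / a)²) with ((/ a)²).
    - apply sqrt_Rsqr, Rlt_le, Rinv_0_lt_compat, Ha.
    - unfold Rsqr; field_simplify_eq; lra. }
  rewrite E; split; field; lra.
Qed.

(* With w = (c f + s g, -s f + c g), the field (f, g) rotated by the fixed angle
   of (c, s), the angle of w is atan (w2 / w1); the rotation drops out of its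
   derivative. *)
Lemma is_derive_rotated_angle (f g : R -> R) (x f' g' c s k : R) :
  is_derive f x f' -> is_derive g x g' ->
  c ^ 2 + s ^ 2 = 1 -> f x ^ 2 + g x ^ 2 = 1 -> 0 < c * f x + s * g x ->
  is_derive (fun z => k + atan ((c * g z + - s * f z) / (c * f z + s * g z))) x
    (f x * g' + -1 * g x * f').
Proof.
  intros Hf Hg Hc Hfg Hpos.
  assert (Ef : ex_derive f x) by (exists f'; exact Hf).
  assert (Eg : ex_derive g x) by (exists g'; exact Hg).
  auto_derive.
  - repeat split; auto; lra.
  - rewrite (is_derive_unique f x f' Hf : Derive (fun z => f z) x = f').
    rewrite (is_derive_unique g x g' Hg : Derive (fun z => g z) x = g').
    set (F := f x) in *; set (G := g x) in *.
    (* Rotation preserves the norm, so the denominator in the derivative of the arctangent becomes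
       1. *)
    assert (HQ : (c * F + s * G) ^ 2 + (c * G + - s * F) ^ 2 = 1).
    { transitivity ((c ^ 2 + s ^ 2) * (F ^ 2 + G ^ 2)); [ring | rewrite Hc, Hfg; ring]. }
    transitivity (((c * g' + - s * f') * (c * F + s * G)
       - (c * G + - s * F) * (c * f' + s * g'))
       / ((c * F + s * G) ^ 2 + (c * G + - s * F) ^ 2)).
    + unfold Rsqr; field; rewrite ?HQ; repeat split; try lra.
    + rewrite HQ.
      transitivity ((c ^ 2 + s ^ 2) * (F * g' + - G * f')); [field | rewrite Hc; ring].
Qed.

(** On the open set where [u] has positive scalar product with its value at p, the angle between the
    two is an arctangent; adding the angle of that value gives the lifting. *)
Lemma local_lifting Omega u p : open Omega -> smooth_circle_valued Omega u ->
  Omega p -> exists U theta, U p /\ lifting Omega u U theta.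
Proof.
  intros HO [H1 [H2 Hn]] Hp; destruct p as [x0 y0].
  pose proof (Hn x0 y0 Hp) as Hn0.
  set (c := comp1 u x0 y0) in *; set (s := comp2 u x0 y0) in *.
  destruct (circle_angle c s Hn0) as [k [Hck Hsk]].
  (* [(w1, w2)] is [u] rotated by the angle -k, which sends the value at p to (1, 0). *)
  set (w1 := fun x y => c * comp1 u x y + s * comp2 u x y).
  set (w2 := fun x y => c * comp2 u x y + - s * comp1 u x y).
  assert (Hw1 : diff_n_on Omega 0 w1).
  { apply diff_n_on_plus; try assumption; apply diff_n_on_mult; try assumption;
      first [apply diff_n_on_const | apply smooth_on_diff_n_on; assumption]. }
  set (U := fun q : R * R => Omega q /\ 0 < w1 (fst q) (snd q)).
  assert (HU : open U).
  { intros [x y] [Ho Hw]; simpl in Hw; apply filter_and; [exact (HO _ Ho)|].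
    pose proof (diff_n_on_continuous Omega 0 w1 x y Hw1 Ho) as C.
    apply continuity_2d_pt_filterlim in C; apply C, (open_gt 0), Hw. }
  assert (HUO : forall q, U q -> Omega q) by (intros q [Hq _]; exact Hq).
  assert (R1 : forall n, diff_n_on U n (comp1 u)) by (intros n x y Hq; apply H1, HUO, Hq).
  assert (R2 : forall n, diff_n_on U n (comp2 u)) by (intros n x y Hq; apply H2, HUO, Hq).
  set (theta := fun x y => k + atan (w2 x y / w1 x y)).
  (* Differentiating the angle gives u1 Du2 - u2 Du1, polynomial in [u] and its derivatives.
     Smoothness of [theta] thus follows from closure under sums and products, with no composition or
     quotient rule at higher order. *)
  set (T := fun (D : (R -> R -> R) -> R -> R -> R) x y =>
     comp1 u x y * D (comp2 u) x y + -1 * comp2 u x y * D (comp1 u) x y).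
  assert (HS : forall n, diff_n_on U (S n) theta).
  { intros n; apply diff_n_on_of_partials with (fx := T Dx) (fy := T Dy).
    - exact HU.
    - intros a b Hab; apply (is_derive_rotated_angle (fun z => comp1 u z b)
        (fun z => comp2 u z b)); try assumption.
      + exact (diff_n_on_is_Dx U 0 _ a b (R1 1%nat) Hab).
      + exact (diff_n_on_is_Dx U 0 _ a b (R2 1%nat) Hab).
      + exact (Hn a b (HUO _ Hab)).
      + exact (proj2 Hab).
    - intros a b Hab; apply (is_derive_rotated_angle (fun z => comp1 u a z)
        (fun z => comp2 u a z)); try assumption.
      + exact (diff_n_on_is_Dy U 0 _ a b (R1 1%nat) Hab).
      + exact (diff_n_on_is_Dy U 0 _ a b (R2 1%nat) Hab).
      + exact (Hn a b (HUO _ Hab)).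
      + exact (proj2 Hab).
    - apply diff_n_on_plus; repeat (apply diff_n_on_mult; try assumption);
        auto using diff_n_on_Dx, diff_n_on_const.
    - apply diff_n_on_plus; repeat (apply diff_n_on_mult; try assumption);
        auto using diff_n_on_Dy, diff_n_on_const. }
  exists U, theta; split; [|split; [|split; [|split]]].
  (* At p itself, [w1] equals c^2 + s^2 = 1. *)
  - split; [exact Hp | unfold w1; simpl; fold c s; nra].
  - exact HU.
  - exact HUO.
  - intros n; apply diff_n_on_pred, HS.
  - intros x y Hq.
    destruct (cos_sin_atan_ratio (w1 x y) (w2 x y)) as [Ec Es].
    + exact (proj2 Hq).
    + transitivity ((c ^ 2 + s ^ 2) * (comp1 u x y ^ 2 + comp2 u x y ^ 2));
        [unfold w1, w2; ring | rewrite Hn0, (Hn x y (HUO _ Hq)); ring].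
    + rewrite (surjective_pairing (u x y)); fold (comp1 u x y) (comp2 u x y).
      (* The addition formulas rotate [(w1, w2)] back by k and recover [u]. *)
      unfold theta; rewrite cos_plus, sin_plus, Ec, Es, <- Hck, <- Hsk.
      unfold w1, w2; f_equal.
      * transitivity ((c ^ 2 + s ^ 2) * comp1 u x y); [rewrite Hn0|]; ring.
      * transitivity ((c ^ 2 + s ^ 2) * comp2 u x y); [rewrite Hn0|]; ring.
Qed.

(** * The divergence equation as a system for the angle and the divergence *)

Lemma div_lifting Omega u U theta x y : lifting Omega u U theta -> U (x, y) ->
  div u x y = - sin (theta x y) * Dx theta x y + cos (theta x y) * Dy theta x y.
Proof.
  intros [HU [_ [HS HL]]] Hp.
  pose proof (smooth_on_diff_n_on U theta 1 HS) as H1.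
  pose proof (open_locally_2d U x y HU Hp) as Hloc.
  unfold div, Dx at 1, Dy at 1; f_equal.
  - apply is_derive_unique.
    apply (is_derive_ext_loc (fun z => cos (theta z y))).
    + generalize (locally_2d_1d_const_y _ _ _ Hloc); apply filter_imp.
      intros z Hz; unfold comp1; rewrite (HL z y Hz); reflexivity.
    + rewrite Rmult_comm; apply (is_derive_comp cos (fun z => theta z y)).
      * apply is_derive_cos.
      * exact (diff_n_on_is_Dx U 0 theta x y H1 Hp).
  - apply is_derive_unique.
    apply (is_derive_ext_loc (fun z => sin (theta x z))).
    + generalize (locally_2d_1d_const_x _ _ _ Hloc); apply filter_imp.
      intros z Hz; unfold comp2; rewrite (HL x z Hz); reflexivity.
    + rewrite Rmult_comm; apply (is_derive_comp sin (fun z => theta x z)).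
      * apply is_derive_sin.
      * exact (diff_n_on_is_Dy U 0 theta x y H1 Hp).
Qed.

(** The first scalar equation is the definition of the divergence and holds for every lifting; the
    second is the transport equation with the perpendicular field (-sin theta, cos theta). *)
Lemma div_transport_iff_scalar_system Omega u U theta : lifting Omega u U theta ->
  (div_transport U u <-> scalar_system U theta (div u)).
Proof.
  intros HL; pose proof HL as [_ [_ [_ Hu]]].
  split; intros H x y Hp; specialize (H x y Hp);
    unfold dot, perp, grad in *; rewrite (Hu x y Hp) in *; simpl in *.
  - split; [symmetry; exact (div_lifting Omega u U theta x y HL Hp) | exact H].
  - exact (proj2 H).
Qed.

(** * Mean value and Gronwall estimates on intervals, in both time directions *)

Lemma connected_segment (J : R -> Prop) a b s : is_connected J -> J a -> J b ->
  Rmin a b <= s <= Rmax a b -> J s.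
Proof.
  intros HJ Ha Hb Hs; apply (HJ (Rmin a b) (Rmax a b)); [| |exact Hs].
  - apply Rmin_case; assumption.
  - apply Rmax_case; assumption.
Qed.

Lemma is_derive_continuity_pt (f : R -> R) x l : is_derive f x l -> continuity_pt f x.
Proof.
  intros H; apply continuity_pt_filterlim.
  exact (ex_derive_continuous f x (ex_intro _ l H)).
Qed.

Lemma MVT_connected (J : R -> Prop) (f f' : R -> R) a b : is_connected J ->
  J a -> J b -> (forall s, J s -> is_derive f s (f' s)) ->
  exists c, Rmin a b <= c <= Rmax a b /\ f b - f a = f' c * (b - a).
Proof.
  intros HJ Ha Hb Hf; apply MVT_gen; intros s Hs.
  - apply Hf, (connected_segment J a b); try assumption; lra.
  - apply (is_derive_continuity_pt f s (f' s)), Hf, (connected_segment J a b); assumption.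
Qed.

Lemma eq_of_same_derivative (J : R -> Prop) (f g h : R -> R) a t : is_connected J ->
  J a -> J t -> f a = g a -> (forall s, J s -> is_derive f s (h s)) ->
  (forall s, J s -> is_derive g s (h s)) -> f t = g t.
Proof.
  intros HJ Ha Ht E Hf Hg.
  destruct (MVT_connected J (fun s => f s - g s) (fun s => h s - h s) a t)
    as [c [_ Hc]]; try assumption.
  - intros s Hs; apply (is_derive_minus f g); auto.
  - lra.
Qed.

(** Multiplying [E] by exp(-k s), with k of the sign of t and of size the maximum of [g] between 0
    and t, gives an increment from 0 to t that is at most 0; since [E] starts at 0 and is
    nonnegative, it vanishes at t. *)
Lemma gronwall_zero (J : R -> Prop) (E E' g : R -> R) t : is_connected J ->
  J 0 -> J t -> E 0 = 0 -> (forall s, J s -> 0 <= E s) ->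
  (forall s, J s -> is_derive E s (E' s)) ->
  (forall s, J s -> continuity_pt g s) ->
  (forall s, J s -> Rabs (E' s) <= g s * E s) -> E t = 0.
Proof.
  intros HJ H0 Ht HE0 Hpos HE Hg Hb.
  destruct (continuity_ab_maj g (Rmin 0 t) (Rmax 0 t)) as [m [Hm _]].
  { apply Rminmax. }
  { intros s Hs; apply Hg, (connected_segment J 0 t); assumption. }
  (* This choice of k treats positive and negative times together. *)
  assert (Hk : exists k, k * t = g m * Rabs t).
  { destruct (Rle_dec 0 t).
    - exists (g m); rewrite Rabs_pos_eq; lra.
    - exists (- g m); rewrite Rabs_left; lra. }
  destruct Hk as [k Hk].
  destruct (MVT_connected J (fun s => E s * exp (- k * s))
    (fun s => (E' s - k * E s) * exp (- k * s)) 0 t) as [c [Hc Heq]]; try assumption.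
  { intros s Hs; pose proof (HE s Hs) as D.
    assert (ED : ex_derive E s) by (exists (E' s); exact D).
    auto_derive; [auto|].
    rewrite (is_derive_unique E s (E' s) D : Derive (fun z => E z) s = E' s); ring. }
  assert (Jc : J c) by (apply (connected_segment J 0 t); assumption).
  pose proof (exp_pos (- k * c)); pose proof (exp_pos (- k * t)).
  pose proof (Hm c Hc); pose proof (Hb c Jc); pose proof (Hpos c Jc).
  pose proof (Hpos t Ht).
  (* At the mean value point, E' t <= g E |t| <= k t E. *)
  assert (Hle : (E' c - k * E c) * t <= 0).
  { pose proof (Rabs_pos t); pose proof (Rle_abs (E' c * t)) as Ha.
    rewrite Rabs_mult in Ha.
    assert (Rabs (E' c) * Rabs t <= g m * E c * Rabs t)
      by (apply Rmult_le_compat_r; nra).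
    replace ((E' c - k * E c) * t) with (E' c * t - (k * t) * E c) by ring.
    rewrite Hk; nra. }
  rewrite HE0 in Heq; nra.
Qed.

Lemma Rabs_sin_sub_le a b : Rabs (sin a - sin b) <= Rabs (a - b).
Proof.
  destruct (MVT_gen sin b a cos) as [c [_ Hc]].
  - intros x _; apply is_derive_sin.
  - intros x _; apply continuity_sin.
  - rewrite Hc, Rabs_mult.
    pose proof (Rabs_pos (a - b)).
    assert (Rabs (cos c) <= 1) by (apply Rabs_le, COS_bound); nra.
Qed.

Lemma Rabs_cos_sub_le a b : Rabs (cos a - cos b) <= Rabs (a - b).
Proof.
  rewrite !cos_sin; eapply Rle_trans; [apply Rabs_sin_sub_le|].
  right; f_equal; ring.
Qed.

(** * Fields restricted to curves in the plane *)

Lemma is_derive_along U f (x y : R -> R) t x' y' : open U -> smooth_on U f ->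
  U (x t, y t) -> is_derive x t x' -> is_derive y t y' ->
  is_derive (fun r => f (x r) (y r)) t (Dx f (x t) (y t) * x' + Dy f (x t) (y t) * y').
Proof.
  intros HU Hf Hp Hx Hy; apply is_derive_Reals, derivable_pt_lim_comp_2d.
  - exact (smooth_on_differentiable U f _ _ HU Hf Hp).
  - apply is_derive_Reals; exact Hx.
  - apply is_derive_Reals; exact Hy.
Qed.

Lemma continuity_pt_along (f : R -> R -> R) (x y : R -> R) t :
  continuity_2d_pt f (x t) (y t) -> continuity_pt x t -> continuity_pt y t ->
  continuity_pt (fun r => f (x r) (y r)) t.
Proof.
  intros Hf Hx Hy; apply continuity_pt_filterlim.
  apply (continuous_comp_2 x y f).
  - apply continuity_pt_filterlim; exact Hx.
  - apply continuity_pt_filterlim; exact Hy.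
  - apply continuity_2d_pt_filterlim; exact Hf.
Qed.

Section AlongCurves.

Variables (U : R * R -> Prop) (theta v : R -> R -> R).
Hypotheses (U_open : open U) (theta_smooth : smooth_on U theta)
  (v_smooth : smooth_on U v) (system : scalar_system U theta v).
Variables (J : R -> Prop) (x y : R -> R).
Hypotheses (J_conn : is_connected J) (J_0 : J 0)
  (U_curve : forall t, J t -> U (x t, y t)).

(** Along the curve the left sides of the system are time derivatives. Constancy of [v] comes first:
    it makes the derivative of [theta] constant. *)
Lemma characteristic_values :
  (forall t, J t -> is_derive x t (- sin (theta (x t) (y t)))) ->
  (forall t, J t -> is_derive y t (cos (theta (x t) (y t)))) ->
  forall t, J t ->
    theta (x t) (y t) = v (x 0) (y 0) * t + theta (x 0) (y 0) /\
    v (x t) (y t) = v (x 0) (y 0).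
Proof.
  intros Hx Hy.
  assert (Hv : forall t, J t -> v (x t) (y t) = v (x 0) (y 0)).
  { intros t Ht.
    apply (eq_of_same_derivative J (fun r => v (x r) (y r)) (fun _ => v (x 0) (y 0))
      (fun _ => 0) 0 t); auto.
    - intros s Hs; destruct (system _ _ (U_curve s Hs)) as [_ E].
      (* The zero derivative is replaced by the left side of the second equation, with factors
         ordered as in the chain rule. *)
      rewrite <- E, (Rmult_comm (- sin _)), (Rmult_comm (cos _)).
      exact (is_derive_along U v x y s _ _ U_open v_smooth (U_curve s Hs) (Hx s Hs) (Hy s Hs)).
    - intros s _; apply (is_derive_const (K := R_AbsRing) (V := R_NormedModule)). }
  intros t Ht; split; [|auto].
  apply (eq_of_same_derivative J (fun r => theta (x r) (y r))
    (fun r => v (x 0) (y 0) * r + theta (x 0) (y 0)) (fun _ => v (x 0) (y 0)) 0 t); auto.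
  - ring.
  - intros s Hs; destruct (system _ _ (U_curve s Hs)) as [E _].
    rewrite <- (Hv s Hs), <- E, (Rmult_comm (- sin _)), (Rmult_comm (cos _)).
    exact (is_derive_along U theta x y s _ _ U_open theta_smooth (U_curve s Hs)
        (Hx s Hs) (Hy s Hs)).
  - intros s _; auto_derive; [trivial | ring].
Qed.

(* Uniqueness for the nonlinear system: w = theta - (v0 t + theta0) and z = v - v0
   along the curve satisfy |w'| <= K |w| + |z| and |z'| <= K |w|, so Gronwall
   applies to w^2 + z^2. *)
Lemma angle_along_prescribed_curve :
  let v0 := v (x 0) (y 0) in let theta0 := theta (x 0) (y 0) in
  (forall t, J t -> is_derive x t (- sin (v0 * t + theta0))) ->
  (forall t, J t -> is_derive y t (cos (v0 * t + theta0))) ->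
  forall t, J t -> theta (x t) (y t) = v0 * t + theta0.
Proof.
  intros v0 theta0 Hx Hy t Ht.
  set (w := fun r => theta (x r) (y r) - (v0 * r + theta0)).
  set (z := fun r => v (x r) (y r) - v0).
  set (w' := fun r => Dx theta (x r) (y r) * - sin (v0 * r + theta0)
     + Dy theta (x r) (y r) * cos (v0 * r + theta0) - v0).
  set (z' := fun r => Dx v (x r) (y r) * - sin (v0 * r + theta0)
     + Dy v (x r) (y r) * cos (v0 * r + theta0)).
  assert (Hw : forall s, J s -> is_derive w s (w' s)).
  { intros s Hs.
    apply (is_derive_minus (fun r => theta (x r) (y r)) (fun r => v0 * r + theta0)).
    - exact (is_derive_along U theta x y s _ _ U_open theta_smooth (U_curve s Hs)
        (Hx s Hs) (Hy s Hs)).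
    - auto_derive; [trivial | ring]. }
  assert (Hz : forall s, J s -> is_derive z s (z' s)).
  { intros s Hs; rewrite <- (Rminus_0_r (z' s)).
    apply (is_derive_minus (fun r => v (x r) (y r)) (fun _ => v0)).
    - exact (is_derive_along U v x y s _ _ U_open v_smooth (U_curve s Hs)
        (Hx s Hs) (Hy s Hs)).
    - apply (is_derive_const (K := R_AbsRing) (V := R_NormedModule)). }
  assert (Hcont : forall f s, smooth_on U f -> J s ->
    continuity_pt (fun r => Rabs (f (x r) (y r))) s).
  { intros f s Hf Hs.
    apply (continuity_pt_comp (fun r => f (x r) (y r)) Rabs); [|apply Rcontinuity_abs].
    apply continuity_pt_along.
    - apply (diff_n_on_continuous U 0); [apply smooth_on_diff_n_on, Hf | auto].
    - apply (is_derive_continuity_pt x s _ (Hx s Hs)).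
    - apply (is_derive_continuity_pt y s _ (Hy s Hs)). }
  assert (SDx : forall f, smooth_on U f -> smooth_on U (Dx f)).
  { intros f Hf n; apply diff_n_on_Dx, smooth_on_diff_n_on, Hf. }
  assert (SDy : forall f, smooth_on U f -> smooth_on U (Dy f)).
  { intros f Hf n; apply diff_n_on_Dy, smooth_on_diff_n_on, Hf. }
  (* [A] and [B] are the continuous coefficients of the Lipschitz bounds on the defects. *)
  set (A := fun r => Rabs (Dx theta (x r) (y r)) + Rabs (Dy theta (x r) (y r))).
  set (B := fun r => Rabs (Dx v (x r) (y r)) + Rabs (Dy v (x r) (y r))).
  assert (HA : forall s, J s -> continuity_pt A s).
  { intros s Hs; apply continuity_pt_plus; apply Hcont; auto. }
  assert (HB : forall s, J s -> continuity_pt B s).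
  { intros s Hs; apply continuity_pt_plus; apply Hcont; auto. }
  (* The rate 2A + B + 1 comes from 2(A W^2 + (B + 1) W Z) <= 2A W^2 + (B + 1)(W^2 + Z^2), where W =
     |w| and Z = |z|. *)
  assert (H : w t * w t + z t * z t = 0).
  { apply (gronwall_zero J (fun r => w r * w r + z r * z r)
      (fun r => (w' r * w r + w r * w' r) + (z' r * z r + z r * z' r))
      (fun r => A r + A r + (B r + 1)) t); auto.
    - unfold w, z, v0, theta0; ring.
    - intros s _; nra.
    - intros s Hs; apply (is_derive_plus (fun r => w r * w r) (fun r => z r * z r)).
      + apply (is_derive_mult w w); auto using Rmult_comm.
      + apply (is_derive_mult z z); auto using Rmult_comm.
    - intros s Hs; repeat apply continuity_pt_plus; auto.
      apply continuity_pt_const; intros a b; reflexivity.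
    - intros s Hs.
      destruct (system _ _ (U_curve s Hs)) as [E1 E2].
      pose proof (Rabs_sin_sub_le (theta (x s) (y s)) (v0 * s + theta0)) as Ls.
      pose proof (Rabs_cos_sub_le (v0 * s + theta0) (theta (x s) (y s))) as Lc.
      rewrite (Rabs_minus_sym (v0 * s + theta0)) in Lc.
      fold (w s) in Ls, Lc.
      set (p := sin (theta (x s) (y s)) - sin (v0 * s + theta0)) in *.
      set (q := cos (v0 * s + theta0) - cos (theta (x s) (y s))) in *.
      (* Subtracting the system at the point of the curve leaves the differences [p] and [q], both
         bounded by |w|. *)
      assert (Ew : w' s = Dx theta (x s) (y s) * p + Dy theta (x s) (y s) * q + z s)
        by (unfold w', z, p, q; rewrite <- E1; ring).
      assert (Ez : z' s = Dx v (x s) (y s) * p + Dy v (x s) (y s) * q).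
      { rewrite <- (Rplus_0_r (z' s)), <- E2 at 1; unfold z', p, q.
        lra. }
      assert (Hlin : forall a b, Rabs (a * p + b * q) <= (Rabs a + Rabs b) * Rabs (w s)).
      { intros a b; eapply Rle_trans; [apply Rabs_triang|].
        rewrite !Rabs_mult; pose proof (Rabs_pos a); pose proof (Rabs_pos b); nra. }
      pose proof (Hlin (Dx theta (x s) (y s)) (Dy theta (x s) (y s))) as K1.
      pose proof (Hlin (Dx v (x s) (y s)) (Dy v (x s) (y s))) as K2.
      fold (A s) in K1; fold (B s) in K2; rewrite <- Ez in K2.
      set (l := Dx theta (x s) (y s) * p + Dy theta (x s) (y s) * q) in *.
      replace (w' s * w s + w s * w' s + (z' s * z s + z s * z' s))
        with (2 * (l * w s + w s * z s + z' s * z s)) by (rewrite Ew; ring).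
      rewrite Rabs_mult, (Rabs_pos_eq 2) by lra.
      assert (T : Rabs (l * w s + w s * z s + z' s * z s)
        <= Rabs l * Rabs (w s) + Rabs (w s) * Rabs (z s) + Rabs (z' s) * Rabs (z s)).
      { rewrite <- !Rabs_mult; eapply Rle_trans; [apply Rabs_triang|].
        apply Rplus_le_compat_r, Rabs_triang. }
      assert (SQ : forall a, a * a = Rabs a * Rabs a).
      { intros a; rewrite <- Rabs_mult, Rabs_pos_eq; nra. }
      rewrite (SQ (w s)), (SQ (z s)).
      assert (HA0 : 0 <= A s) by (apply Rplus_le_le_0_compat; apply Rabs_pos).
      assert (HB0 : 0 <= B s) by (apply Rplus_le_le_0_compat; apply Rabs_pos).
      pose proof (Rabs_pos (w s)) as W0; pose proof (Rabs_pos (z s)) as Z0.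
      set (W := Rabs (w s)) in *; set (Z := Rabs (z s)) in *.
      assert (Rabs l * W <= A s * W * W) by (apply Rmult_le_compat_r; assumption).
      assert (Rabs (z' s) * Z <= B s * W * Z) by (apply Rmult_le_compat_r; assumption).
      assert (0 <= (B s + 1) * (W - Z) ^ 2)
        by (apply Rmult_le_pos; [lra | apply pow2_ge_0]).
      assert (0 <= A s * (Z * Z)) by (apply Rmult_le_pos; [lra | apply Rmult_le_pos; lra]).
      nra. }
  assert (w t = 0) by nra.
  unfold w in *; lra.
Qed.

End AlongCurves.

(** * Derivatives and curvature of the explicit circular motion *)

Section CircularFlow.

Variables (k c xc yc : R) (J : R -> Prop) (x y : R -> R).
Hypothesis J_open : open J.

Lemma circular_flow_derive : k <> 0 ->
  (forall t, J t -> x t = / k * (cos (k * t + c) - cos c) + xc /\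
                    y t = / k * (sin (k * t + c) - sin c) + yc) ->
  forall t, J t -> is_derive x t (- sin (k * t + c)) /\ is_derive y t (cos (k * t + c)).
Proof.
  intros Hk H t Ht; split.
  - apply (is_derive_ext_loc (fun r => / k * (cos (k * r + c) - cos c) + xc)).
    + generalize (J_open t Ht); apply filter_imp; intros r Hr; symmetry; apply H, Hr.
    + auto_derive; [trivial | field; exact Hk].
  - apply (is_derive_ext_loc (fun r => / k * (sin (k * r + c) - sin c) + yc)).
    + generalize (J_open t Ht); apply filter_imp; intros r Hr; symmetry; apply H, Hr.
    + auto_derive; [trivial | field; exact Hk].
Qed.

Lemma circular_flow_arc : k <> 0 ->
  (forall t, J t -> x t = / k * (cos (k * t + c) - cos c) + xc /\
                    y t = / k * (sin (k * t + c) - sin c) + yc) ->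
  circular_arc J x y k.
Proof.
  intros Hk H; pose proof (circular_flow_derive Hk H) as D; split.
  (* The centre is what remains of the formulas once the terms oscillating in t are dropped. *)
  - exists (xc - cos c / k), (yc - sin c / k); intros t Ht.
    destruct (H t Ht) as [-> ->].
    rewrite <- Rabs_inv, <- !Rsqr_pow2, <- Rsqr_abs, !Rsqr_pow2.
    pose proof (sin2_cos2 (k * t + c)) as E; rewrite !Rsqr_pow2 in E.
    transitivity ((/ k) ^ 2 * (sin (k * t + c) ^ 2 + cos (k * t + c) ^ 2));
      [field; exact Hk | rewrite E; ring].
  - intros t Ht.
    pose proof (sin2_cos2 (k * t + c)) as E; rewrite !Rsqr_pow2 in E.
    assert (S1 : (- sin (k * t + c)) ^ 2 + cos (k * t + c) ^ 2 = 1) by (rewrite <- E; ring).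
    (* The speed is 1 and the acceleration is k times the velocity turned by a quarter circle, so
       the signed curvature is k. *)
    exists (fun r => - sin (k * r + c)), (fun r => cos (k * r + c)),
      (- k * cos (k * t + c)), (- k * sin (k * t + c)).
    split; [|split; [|split; [|split; [|split]]]].
    + generalize (J_open t Ht); apply filter_imp; intros r Hr; apply D, Hr.
    + generalize (J_open t Ht); apply filter_imp; intros r Hr; apply D, Hr.
    + auto_derive; [trivial | ring].
    + auto_derive; [trivial | ring].
    + rewrite S1; lra.
    + rewrite S1, sqrt_1.
      transitivity (k * (sin (k * t + c) ^ 2 + cos (k * t + c) ^ 2));
        [rewrite E; ring | field].
Qed.

End CircularFlow.

(** * Explicit form of the characteristics of the system *)

Theorem corollary4p2 (Omega : R * R -> Prop) (u : R -> R -> R * R)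
    (Omega_open : open Omega) (u_smooth : smooth_circle_valued Omega u) :
  (forall p, Omega p -> exists U theta, U p /\ lifting Omega u U theta) /\
  forall (U : R * R -> Prop) (theta : R -> R -> R),
    lifting Omega u U theta ->
    let v := div u in
    (div_transport U u <-> scalar_system U theta v) /\
    (div_transport Omega u ->
     forall (I : R -> Prop) (x0 y0 : R -> R),
       initial_curve Omega I x0 y0 ->
       let theta0 := fun s => theta (x0 s) (y0 s) in
       let v0 := fun s => v (x0 s) (y0 s) in
       forall s, I s -> U (x0 s, y0 s) ->
         (v0 s <> 0 ->
          forall (J : R -> Prop) (x y : R -> R), time_interval J ->
            (characteristic U theta (x0 s) (y0 s) J x y <->
             forall t, J t ->
               U (x t, y t) /\
               x t = / v0 s * (cos (v0 s * t + theta0 s) - cos (theta0 s)) + x0 s /\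
               y t = / v0 s * (sin (v0 s * t + theta0 s) - sin (theta0 s)) + y0 s) /\
            (characteristic U theta (x0 s) (y0 s) J x y ->
             circular_arc J x y (v0 s))) /\
         (forall (J : R -> Prop) (x y : R -> R), time_interval J ->
            characteristic U theta (x0 s) (y0 s) J x y ->
            forall t, J t ->
              theta (x t) (y t) = v0 s * t + theta0 s /\
              v (x t) (y t) = v0 s) /\
         (v0 s = 0 ->
          exists a b : R, (a, b) <> (0, 0) /\
          forall (J : R -> Prop) (x y : R -> R), time_interval J ->
            (characteristic U theta (x0 s) (y0 s) J x y <->
             forall t, J t ->
               U (x t, y t) /\ x t = x0 s + t * a /\ y t = y0 s + t * b))).
Proof.
  split; [intros p Hp; exact (local_lifting Omega u p Omega_open u_smooth Hp)|].
  intros U theta HL v.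
  pose proof HL as [HU [HUO [HS Hu]]].
  split; [exact (div_transport_iff_scalar_system Omega u U theta HL)|].
  intros HD Ic x0 y0 _ theta0 v0 s _ HUs.
  (* The transport equation on [Omega] restricts to [U], where the equivalence applies. *)
  assert (Hsys : scalar_system U theta v).
  { apply (div_transport_iff_scalar_system Omega u U theta HL).
    intros x y Hp; exact (HD x y (HUO _ Hp)). }
  assert (HSv : smooth_on U v).
  { intros n x y Hp; destruct u_smooth as [H1 [H2 _]].
    exact (smooth_on_div Omega u Omega_open H1 H2 n x y (HUO _ Hp)). }
  assert (Hval : forall (J : R -> Prop) (x y : R -> R), time_interval J ->
    characteristic U theta (x0 s) (y0 s) J x y ->
    forall t, J t ->
      theta (x t) (y t) = v0 s * t + theta0 s /\ v (x t) (y t) = v0 s).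
  { intros J x y [_ [Jc J0]] [Ex [Ey H]].
    unfold v0, theta0; rewrite <- Ex, <- Ey.
    apply (characteristic_values U theta v HU HS HSv Hsys J x y Jc J0);
      intros t Ht; apply (H t Ht). }
  (* The unknown angle on the right side is replaced by the known function v0 t + theta0, which
     reduces both cases to plain integration. The forward direction uses the constancy laws, the
     converse the Gronwall uniqueness. *)
  assert (Hchar : forall (J : R -> Prop) (x y : R -> R), time_interval J ->
    characteristic U theta (x0 s) (y0 s) J x y <->
    x 0 = x0 s /\ y 0 = y0 s /\ forall t, J t -> U (x t, y t) /\
      is_derive x t (- sin (v0 s * t + theta0 s)) /\
      is_derive y t (cos (v0 s * t + theta0 s))).
  { intros J x y HJ; split.
    - intros HC; pose proof HC as [Ex [Ey H]].
      split; [exact Ex | split; [exact Ey |]]; intros t Ht.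
      rewrite <- (proj1 (Hval J x y HJ HC t Ht)); exact (H t Ht).
    - intros [Ex [Ey H]]; split; [exact Ex | split; [exact Ey |]]; intros t Ht.
      assert (E : theta (x t) (y t) = v0 s * t + theta0 s).
      { destruct HJ as [_ [Jc J0]]; revert H; unfold v0, theta0.
        rewrite <- Ex, <- Ey; intros H.
        apply (angle_along_prescribed_curve U theta v HU HS HSv Hsys J x y Jc J0);
          first [exact Ht | intros r Hr; apply (H r Hr)]. }
      rewrite E; exact (H t Ht). }
  split; [|split; [exact Hval|]].
  - intros Hv0 J x y HJ; pose proof HJ as [Jo [Jc J0]].
    pose proof (circular_flow_derive (v0 s) (theta0 s) (x0 s) (y0 s) J) as Dflow.
    assert (Hflow : characteristic U theta (x0 s) (y0 s) J x y -> forall t, J t ->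
      x t = / v0 s * (cos (v0 s * t + theta0 s) - cos (theta0 s)) + x0 s /\
      y t = / v0 s * (sin (v0 s * t + theta0 s) - sin (theta0 s)) + y0 s).
    { intros HC t Ht; apply Hchar in HC; [|exact HJ]; destruct HC as [Ex [Ey H]].
      (* Applied to the explicit formulas themselves, to compare their derivatives with those of the
         characteristic. *)
      specialize (Dflow
        (fun r => / v0 s * (cos (v0 s * r + theta0 s) - cos (theta0 s)) + x0 s)
        (fun r => / v0 s * (sin (v0 s * r + theta0 s) - sin (theta0 s)) + y0 s)
        Jo Hv0 (fun r _ => conj eq_refl eq_refl)).
      split.
      - eapply (eq_of_same_derivative J x
          (fun r => / v0 s * (cos (v0 s * r + theta0 s) - cos (theta0 s)) + x0 s)
          _ 0 t Jc J0 Ht);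
          [|intros r Hr; exact (proj1 (proj2 (H r Hr))) | intros r Hr; apply Dflow, Hr].
        rewrite Ex, Rmult_0_r, Rplus_0_l; ring.
      - eapply (eq_of_same_derivative J y
          (fun r => / v0 s * (sin (v0 s * r + theta0 s) - sin (theta0 s)) + y0 s)
          _ 0 t Jc J0 Ht);
          [|intros r Hr; exact (proj2 (proj2 (H r Hr))) | intros r Hr; apply Dflow, Hr].
        rewrite Ey, Rmult_0_r, Rplus_0_l; ring. }
    split; [split|].
    + intros HC t Ht; split; [apply HC, Ht | exact (Hflow HC t Ht)].
    + intros H; apply Hchar; [exact HJ|].
      (* At time 0 the formulas return the initial point. *)
      destruct (H 0 J0) as [_ [Ex Ey]].
      rewrite Rmult_0_r, Rplus_0_l in Ex, Ey.
      split; [rewrite Ex; ring | split; [rewrite Ey; ring |]].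
      intros t Ht; split; [apply H, Ht|].
      exact (Dflow x y Jo Hv0 (fun r Hr => proj2 (H r Hr)) t Ht).
    + intros HC; exact (circular_flow_arc (v0 s) (theta0 s) (x0 s) (y0 s) J x y Jo Hv0
        (Hflow HC)).
  (* The direction of the line is the unit vector perpendicular to [u] at the initial point. *)
  - intros Hv0; exists (- sin (theta0 s)), (cos (theta0 s)).
    split.
    { intros E; injection E as E1 E2; pose proof (sin2_cos2 (theta0 s)) as E.
      unfold Rsqr in E; nra. }
    intros J x y HJ; pose proof HJ as [Jo [Jc J0]].
    (* With zero divergence the angle stays constant, and so does the velocity. *)
    assert (Hphi : forall t, v0 s * t + theta0 s = theta0 s) by (intros t; rewrite Hv0; ring).
    assert (Dline : forall a b t, is_derive (fun r => a + r * b) t b)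
      by (intros a b t; auto_derive; [trivial | ring]).
    split.
    + intros HC t Ht; apply Hchar in HC; [|exact HJ]; destruct HC as [Ex [Ey H]].
      split; [apply H, Ht | split].
      * apply (eq_of_same_derivative J x (fun r => x0 s + r * - sin (theta0 s))
          (fun _ => - sin (theta0 s)) 0 t Jc J0 Ht); [lra | | auto].
        intros r Hr; rewrite <- (Hphi r); apply (H r Hr).
      * apply (eq_of_same_derivative J y (fun r => y0 s + r * cos (theta0 s))
          (fun _ => cos (theta0 s)) 0 t Jc J0 Ht); [lra | | auto].
        intros r Hr; rewrite <- (Hphi r); apply (H r Hr).
    + intros H; apply Hchar; [exact HJ|].
      destruct (H 0 J0) as [_ [Ex Ey]].
      split; [lra | split; [lra |]].
      intros t Ht; rewrite Hphi; split; [apply H, Ht | split].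
      * apply (is_derive_ext_loc (fun r => x0 s + r * - sin (theta0 s))); [|apply Dline].
        generalize (Jo t Ht); apply filter_imp; intros r Hr; symmetry; apply (H r Hr).
      * apply (is_derive_ext_loc (fun r => y0 s + r * cos (theta0 s))); [|apply Dline].
        generalize (Jo t Ht); apply filter_imp; intros r Hr; symmetry; apply (H r Hr).
Qed.
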